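(* The full subcategory $\mathbf{plFs}$ of pointless frames is $\mathfrak{E}$-reflective in $\mathbf{Fs}$; that is, $\mathbf{plFs}$ is reflective in $\mathbf{Fs}$ with all reflector arrows in $\mathfrak{E}$.
   Context: All frames are completely regular (the one-element frame is allowed); frame homomorphisms preserve finite meets and arbitrary joins. $\max L$ is the set of maximal elements of $L\setminus\{\top\}$. A frame $L$ is pointless if $\max L=\emptyset$. An element $c$ is a successor of $a$ if $c>a$ and there is no $b$ with $a<b<c$. $\pi L=\{a\in L:a\text{ has no successor}\}$ is a sublocale of $L$, with quotient map $\pi_L:L\to\pi L$, $\pi_L(b)=\bigwedge\{a\in\pi L:a\ge b\}$. A frame homomorphism $m:L\to M$ is skinny if $\pi_M(m(a))=\top$ for all $a\in\max L$. $\mathbf{Fs}$ is the category of frames and skinny homomorphisms. For $a\in L$ let $\Phi_a=\{(a_1,a_2):a\wedge a_1=a\wedge a_2\}$ and for a frame surjection $e$ let $\Theta_e=\{(a_1,a_2):e(a_1)=e(a_2)\}$. $\mathfrak{E}$ is the class of surjections $e:L\to M$ in $\mathbf{Fs}$ such that $\Theta_e=\bigvee\{\Phi_a:a\in\max L,\ e(a)=\top\}$, the join being taken in the frame of congruences of $L$. *)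

(* Defs.v *)
From HB Require Import structures.
From mathcomp Require Import all_boot all_order all_algebra.
From mathcomp Require Import boolp classical_sets.

Set Implicit Arguments.
Unset Strict Implicit.
Unset Printing Implicit Defensive.

Import Order.TTheory.

Local Open Scope classical_set_scope.
Local Open Scope order_scope.

(* [supremums A] is the set of least upper bounds of [A].  Nothing excludes
   \bot = \top, so the one-element frame is allowed. *)
HB.mixin Record TBLattice_isFrame (d : Order.disp_t) T of Order.TBLattice d T := {
  fsup : set T -> T;
  fsup_supremum : forall A : set T, supremums A (fsup A);
  meet_fsupr : forall (a : T) (A : set T),
    a `&` fsup A = fsup [set a `&` b | b in A];
}.

#[short(type="frameType")]
HB.structure Definition Frame (d : Order.disp_t) :=
  { T of Order.TBLattice d T & TBLattice_isFrame d T }.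

Section FrameNotions.
Context {d : Order.disp_t} {L : frameType d}.
Implicit Types (a b c : L) (A : set L).

Definition finf A : L := fsup (lbound A).

Definition pseudocompl a : L := fsup [set x | a `&` x = \bot].

Definition rather_below a b := pseudocompl a `|` b = \top.

(* There is a scale from a to b indexed by the rationals of [0, 1]; only the
   values of [s] on [0, 1] matter. *)
Definition completely_below a b := exists s : rat -> L,
  [/\ s 0%R = a, s 1%R = b &
    forall p q : rat, (0 <= p)%R -> (p < q)%R -> (q <= 1)%R ->
      rather_below (s p) (s q)].

End FrameNotions.

HB.mixin Record Frame_isCompletelyRegular (d : Order.disp_t) T of Frame d T := {
  completely_regular : forall a : T, fsup [set b : T | completely_below b a] = a;
}.

#[short(type="crFrameType")]
HB.structure Definition CRFrame (d : Order.disp_t) :=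
  { T of Frame d T & Frame_isCompletelyRegular d T }.

Definition frame_hom (d d' : Order.disp_t) (L : frameType d) (M : frameType d')
    (f : L -> M) :=
  [/\ f \top = \top,
      forall a b, f (a `&` b) = f a `&` f b &
      forall A : set L, f (fsup A) = fsup (f @` A)].

Section Points.
Context {d : Order.disp_t}.
Variable L : frameType d.
Implicit Types (a b c : L).

Definition maxels : set L :=
  [set a | a != \top /\ forall b, b != \top -> a <= b -> b = a].

Definition pointless := maxels = set0.

Definition successor a c := a < c /\ ~ exists b, a < b /\ b < c.

Definition pi_sub : set L := [set a | ~ exists c, successor a c].

(* The quotient map of pi L, with values regarded as elements of L; the top
   of the sublocale pi L is the top of L. *)
Definition pi_map b : L := finf [set a | pi_sub a /\ b <= a].

End Points.

Arguments maxels {d} L.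
Arguments pointless {d} L.
Arguments pi_sub {d} L.

Definition is_skinny (d d' : Order.disp_t) (L : frameType d) (M : frameType d')
    (m : L -> M) :=
  forall a, maxels L a -> pi_map (m a) = \top.

Record skinny_hom (d d' : Order.disp_t) (L : crFrameType d) (M : crFrameType d') :=
  SkinnyHom {
    skinny_fun :> L -> M;
    skinny_frame_hom : frame_hom skinny_fun;
    skinny_is_skinny : is_skinny skinny_fun
  }.

Section Congruences.
Context {d : Order.disp_t} {L : frameType d}.
Implicit Types (a : L) (R : set (L * L)).

Definition congruence R :=
  [/\ forall a, R (a, a),
      forall a b, R (a, b) -> R (b, a),
      forall a b c, R (a, b) -> R (b, c) -> R (a, c),
      forall a a' b b', R (a, a') -> R (b, b') -> R (a `&` b, a' `&` b') &
      forall S, S `<=` R -> R (fsup (fst @` S), fsup (snd @` S))].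

(* Congruences are ordered by inclusion; see [cong_join_lub]. *)
Definition cong_join (C : set (set (L * L))) : set (L * L) :=
  [set xy | forall R, congruence R -> (forall S, C S -> S `<=` R) -> R xy].

Definition Phi a : set (L * L) := [set xy | a `&` xy.1 = a `&` xy.2].

Definition Theta (d' : Order.disp_t) (M : frameType d') (e : L -> M) :
    set (L * L) := [set xy | e xy.1 = e xy.2].

Lemma cong_join_lub C :
  [/\ congruence (cong_join C),
      forall S, C S -> S `<=` cong_join C &
      forall R, congruence R -> (forall S, C S -> S `<=` R) ->
        cong_join C `<=` R].
Proof.
split; last by move=> R cR CR xy; apply.
  split=> [a|a b ab|a b c ab bc|a a' b b' aa' bb'|S SC] R cR CR;
    case: (cR) => r s t m j.
  - exact: r.
  - exact: s (ab R cR CR).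
  - exact: t (ab R cR CR) (bc R cR CR).
  - exact: m (aa' R cR CR) (bb' R cR CR).
  - by apply: j => xy /SC /(_ R cR CR).
by move=> S CS xy Sxy R cR CR; exact: CR CS _ Sxy.
Qed.

End Congruences.

Definition class_E (d d' : Order.disp_t) (L : crFrameType d) (M : crFrameType d')
    (e : skinny_hom L M) :=
  (forall y, exists x, e x = y) /\
  Theta e = cong_join [set Phi a | a in [set a | maxels L a /\ e a = \top]].

Record category := Category {
  ob :> Type;
  hom : ob -> ob -> Type;
  idm : forall X, hom X X;
  comp : forall X Y Z, hom Y Z -> hom X Y -> hom X Z;
  comp_idl : forall X Y (f : hom X Y), comp (idm Y) f = f;
  comp_idr : forall X Y (f : hom X Y), comp f (idm X) = f;
  comp_assoc : forall X Y Z W (h : hom Z W) (g : hom Y Z) (f : hom X Y),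
    comp h (comp g f) = comp (comp h g) f
}.

Section Reflective.
Variables (C : category) (A : C -> Prop).

(* A full subcategory is given by its class of objects [A]. *)
Definition reflector_arrow (X Y : C) (r : hom X Y) :=
  A Y /\ forall Z : C, A Z -> forall f : hom X Z,
    exists! g : hom Y Z, comp g r = f.

Definition reflective := forall X : C, exists (Y : C) (r : hom X Y),
  reflector_arrow r.

Definition reflective_within (E : forall X Y : C, hom X Y -> Prop) :=
  reflective /\
  forall (X Y : C) (r : hom X Y), reflector_arrow r -> E X Y r.

End Reflective.

Section FrameTheory.
Context {d : Order.disp_t} {L : frameType d}.
Implicit Types (a b c : L) (A : set L).

Lemma fsup_ub A a : A a -> a <= fsup A.
Proof. by case: (fsup_supremum A) => + _; apply. Qed.

Lemma fsup_least A b : (forall a, A a -> a <= b) -> fsup A <= b.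
Proof. by case: (fsup_supremum A) => _; apply. Qed.

Lemma meet_fsup_le a A b : (forall x, A x -> a `&` x <= b) -> a `&` fsup A <= b.
Proof. by move=> h; rewrite meet_fsupr; apply: fsup_least => _ [x /h + <-]. Qed.

Lemma meet_joinr a b c : a `&` (b `|` c) <= (a `&` b) `|` (a `&` c).
Proof.
have /(leI2 (lexx a)) : b `|` c <= fsup [set b; c].
  by rewrite leUx !fsup_ub //=; [right|left].
move/le_trans; apply; apply: meet_fsup_le => x [->|->].
  exact: leUl.
exact: leUr.
Qed.

Definition himp a b : L := fsup [set x | a `&` x <= b].

Lemma le_himp a b x : (x <= himp a b) = (a `&` x <= b).
Proof.
apply/idP/idP => [h|]; last exact: fsup_ub.
by apply: le_trans (leI2 (lexx a) h) _; apply: meet_fsup_le.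
Qed.

Lemma le_finf A b : (forall a, A a -> b <= a) -> b <= finf A.
Proof. by move=> h; apply: fsup_ub => a /h. Qed.

Lemma finf_lb A a : A a -> finf A <= a.
Proof. by move=> Aa; apply: fsup_least => b; apply. Qed.

Lemma pi_map_topP b :
  pi_map b = \top <-> forall a, pi_sub L a -> b <= a -> a = \top.
Proof.
split=> [h a pa ba|h]; apply/eqP; rewrite -le1x.
  by rewrite -h; apply: finf_lb.
by apply: le_finf => a [pa ba]; rewrite (h a).
Qed.

Lemma successor_eq a c b : successor a c -> a < b -> b <= c -> b = c.
Proof.
move=> [_ nac] ab; rewrite le_eqVlt => /orP[/eqP//|bc].
by case: nac; exists b.
Qed.

Lemma pi_sub_himp x c : pi_sub L c -> pi_sub L (himp x c).
Proof.
move=> pc [s ss]; apply: pc; set w := himp x c in ss.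
have [ws nws] := ss.
have cw : c <= w by rewrite le_himp leIr.
exists (c `|` (x `&` s)); split.
  rewrite lt_leAnge leUl leUx lexx /= -le_himp -/w.
  by apply/negP => /(lt_le_trans ws); rewrite ltxx.
case=> u [cu ut].
have wE : w `|` (u `&` s) = s.
  apply: (successor_eq ss); last by rewrite leUx (ltW ws) leIr.
  rewrite lt_leAnge leUl leUx lexx /= le_himp; apply/negP => h.
  have : u <= c.
    have -> : u = u `&` (c `|` (x `&` s)) by apply/esym/meet_idPl/ltW.
    apply: le_trans (meet_joinr _ _ _) _; rewrite leUx leIr /=.
    by rewrite meetCA.
  by move=> /(lt_le_trans cu); rewrite ltxx.
suff : c `|` (x `&` s) <= u by move=> /(lt_le_trans ut); rewrite ltxx.
rewrite leUx (ltW cu) /= -wE; apply: le_trans (meet_joinr _ _ _) _.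
rewrite leUx; apply/andP; split.
  by apply: le_trans (ltW cu); rewrite -le_himp.
by rewrite meetCA leIl.
Qed.

End FrameTheory.

Lemma frame_hom_le (d d' : Order.disp_t) (L : frameType d) (M : frameType d')
  (f : L -> M) : frame_hom f -> forall a b, a <= b -> f a <= f b.
Proof. by move=> [_ fI _] a b /meet_idPl <-; rewrite fI leIr. Qed.

Lemma rather_below_completely_below (d : Order.disp_t) (L : frameType d)
  (a b : L) : completely_below a b -> rather_below a b.
Proof. by move=> [s [<- <-]]; apply. Qed.

Lemma maxels_himp (d : Order.disp_t) (L : crFrameType d) (a c : L) :
  successor a c -> maxels L (himp c a).
Proof.
move=> ss; have [ac _] := ss; set p := himp c a.
split=> [|q qT pq].
  rewrite -le1x le_himp meetx1; apply/negP => /(lt_le_trans ac).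
  by rewrite ltxx.
apply/eqP; rewrite eq_le pq andbT -[leLHS]completely_regular.
apply: fsup_least => x /= /rather_below_completely_below xq.
rewrite le_himp; apply/negPn/negP => ncx.
case/negP: qT; rewrite -xq eq_le leUr /= leUx lexx andbT.
apply: le_trans pq; rewrite le_himp.
have cE : a `|` (c `&` x) = c.
  apply: (successor_eq ss); last by rewrite leUx (ltW ac) leIl.
  by rewrite lt_leAnge leUl leUx lexx.
rewrite -{1}cE meetC; apply: le_trans (meet_joinr _ _ _) _.
rewrite leUx leIr /= meetC -meetA; apply: le_trans (leIr _ _) _.
by apply: meet_fsup_le => y /= ->; apply: le0x.
Qed.

Section FsCategory.
Variable d : Order.disp_t.

Lemma skinny_hom_eq (L M : crFrameType d) (f g : skinny_hom L M) :
  (forall x, f x = g x) -> f = g.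
Proof.
case: f g => f f1 f2 [g g1 g2] /= /funext fg.
by case: _ / fg in g1 g2 *; congr SkinnyHom; apply: Prop_irrelevance.
Qed.

Lemma frame_hom_id (L : frameType d) : frame_hom (@id L).
Proof. by split=> // A; rewrite image_id. Qed.

Lemma is_skinny_id (L : frameType d) : is_skinny (@id L).
Proof.
move=> a [aT amax]; apply/pi_map_topP => b pb ab.
apply/eqP/negPn/negP => bT; apply: pb; exists \top.
rewrite (amax b bT ab); split; first by rewrite lt_neqAle aT lex1.
case=> e [ae eT]; have eE := amax e (negbT (lt_eqF eT)) (ltW ae).
by rewrite eE ltxx in ae.
Qed.

Lemma frame_hom_comp (L M N : frameType d) (g : M -> N) (f : L -> M) :
  frame_hom g -> frame_hom f -> frame_hom (g \o f).
Proof.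
move=> [gT gI gS] [fT fI fS]; split=> [|a b|A] /=.
- by rewrite fT gT.
- by rewrite fI gI.
- by rewrite fS gS image_comp.
Qed.

Lemma is_skinny_comp (L M N : crFrameType d) (g : skinny_hom M N)
  (f : skinny_hom L M) : is_skinny (g \o f).
Proof.
move=> a amax; apply/pi_map_topP => c pc /= fac.
have ghom := skinny_frame_hom g; have [gT gI gS] := ghom.
pose u : M := fsup [set x | g x <= c].
have guc : g u <= c by rewrite gS; apply: fsup_least => _ [x gx <-].
suff pu : pi_sub M u.
  have /pi_map_topP/(_ u pu (fsup_ub _)) uT := skinny_is_skinny f amax.
  by apply/eqP; rewrite -le1x -gT -(uT fac).
move=> [v suv]; have := skinny_is_skinny g (maxels_himp suv).
move=> /pi_map_topP/(_ _ (pi_sub_himp (x := g v) pc)) h.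
have /h hT : g (himp v u) <= himp (g v) c.
  rewrite le_himp -gI; apply: le_trans guc; apply: (frame_hom_le ghom).
  by rewrite -le_himp.
have gvc : g v <= c by rewrite -[g v]meetx1 -le_himp hT.
by have [/lt_geF + _] := suv; rewrite fsup_ub.
Qed.

Definition skinny_id (L : crFrameType d) : skinny_hom L L :=
  SkinnyHom (@frame_hom_id L) (@is_skinny_id L).

Definition skinny_comp (L M N : crFrameType d) (g : skinny_hom M N)
    (f : skinny_hom L M) : skinny_hom L N :=
  SkinnyHom (frame_hom_comp (skinny_frame_hom g) (skinny_frame_hom f))
            (is_skinny_comp g f).

(* [d] is only the MathComp order display and carries no mathematical
   content. *)
Definition Fs : category.
Proof.
apply: (@Category (crFrameType d) (@skinny_hom d d) skinny_id skinny_comp).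
- by move=> L M f; apply: skinny_hom_eq.
- by move=> L M f; apply: skinny_hom_eq.
- by move=> L M N P h g f; apply: skinny_hom_eq.
Defined.

Definition plFs : Fs -> Prop := fun L => pointless L.

Definition Fs_E : forall X Y : Fs, hom X Y -> Prop := @class_E d d.

End FsCategory.

(* Main.v *)
Require Import Defs.
From mathcomp Require Import all_boot all_order.
From HB Require Import structures.
From mathcomp Require Import boolp classical_sets.

(** Since frames here are completely regular, a successor [c] of [a] yields the
    maximal element [himp c a] (lemma [maxels_himp]).  So a pointless frame [M]
    has no successors, [pi M] is all of [M], and a frame homomorphism into [M]
    is skinny exactly when it sends every maximal element to the top
    ([skinny_to_pointless]).

    A frame homomorphism [f] with [f a = \top] satisfies
    [f x = f (a `&` x)], so its kernel contains [Phi a].  Hence the kernel of a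
    skinny homomorphism from [L] to a pointless frame contains the join
    [max_cong L] of all [Phi a] with [a] maximal, and it factors uniquely
    through the quotient of [L] by [max_cong L] ([hom_factor]).

    It remains to see that this quotient is itself pointless
    ([pointless_quotient]).  The right adjoint of a surjection [q] carries a
    maximal element [b] of the quotient to a prime of [L]; primes of a regular
    frame are maximal, so [b = q p] for a maximal [p], which contradicts
    [q p = \top].  Thus collapsing the points of [L] once creates no new ones.

    The quotient map therefore is a reflector arrow, and it lies in the class
    E by construction.  Any other reflector arrow differs from it by an
    isomorphism, which changes neither surjectivity nor the kernel. *)

Set Implicit Arguments.
Unset Strict Implicit.
Unset Printing Implicit Defensive.

Import Order.TTheory.

Local Open Scope classical_set_scope.
Local Open Scope order_scope.

(** * Frame homomorphisms and regularity *)

Lemma fsup_eq (d : Order.disp_t) (L : frameType d) (A : set L) (s : L) :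
  (forall a, A a -> a <= s) -> (forall b, (forall a, A a -> a <= b) -> s <= b) ->
  fsup A = s.
Proof.
move=> ub lub; apply/eqP; rewrite eq_le fsup_least //=.
by apply: lub => a; apply: fsup_ub.
Qed.

Lemma fsup2 (d : Order.disp_t) (L : frameType d) (a b : L) :
  fsup [set a; b] = a `|` b.
Proof.
apply: fsup_eq => [x [->|->]|c h]; rewrite ?leUl ?leUr //.
by rewrite leUx !h //=; [right|left].
Qed.

Lemma rather_below_le (d : Order.disp_t) (L : frameType d) (a b : L) :
  rather_below a b -> a <= b.
Proof.
move=> ab; rewrite -[a]meetx1 -ab; apply: le_trans (meet_joinr _ _ _) _.
rewrite leUx leIr andbT; apply: meet_fsup_le => x /= ->; exact: le0x.
Qed.

Lemma completely_below_le (d : Order.disp_t) (L : frameType d) (a b : L) :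
  completely_below a b -> a <= b.
Proof. by move/rather_below_completely_below/rather_below_le. Qed.

(** The argument that points of a regular frame are closed: if [p <= c] and [x]
    is rather below [c], then either [x <= p], or primality puts the
    pseudocomplement of [x] below [p], whence [c = \top].  So [c], a join of
    such [x], is at most [p]. *)
Lemma prime_maxel (d : Order.disp_t) (L : crFrameType d) (p : L) :
  p != \top -> (forall x y, x `&` y <= p -> x <= p \/ y <= p) -> maxels L p.
Proof.
move=> pT pr; split=> // c cT pc; apply/eqP; rewrite eq_le pc andbT.
rewrite -[leLHS]completely_regular; apply: fsup_least => x /=.
move=> /rather_below_completely_below xc.
have /pr[//|xp] : x `&` pseudocompl x <= p.
  by apply: meet_fsup_le => y /= ->; apply: le0x.
by case/eqP: cT; rewrite -xc; apply/esym/join_idPr/(le_trans xp).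
Qed.

(** If [b `|` x = \top], distributivity writes [y] as the join of [y `&` b] and
    [y `&` x], both below [b]. *)
Lemma maxel_prime (d : Order.disp_t) (L : frameType d) (b x y : L) :
  maxels L b -> x `&` y <= b -> x <= b \/ y <= b.
Proof.
move=> [_ bmax] xyb; have [xb|nxb] := boolP (x <= b); [by left|right].
have bxT : b `|` x = \top.
  apply/eqP/negPn/negP => bxT; case/negP: nxb.
  by rewrite -(bmax _ bxT (leUl _ _)) leUr.
rewrite -[y]meetx1 -bxT; apply: le_trans (meet_joinr _ _ _) _.
by rewrite leUx leIr meetC.
Qed.

Section FrameHom.
Variables (d d' : Order.disp_t) (L : frameType d) (M : frameType d').
Variables (f : L -> M) (fhom : frame_hom f).

Lemma frame_homU (a b : L) : f (a `|` b) = f a `|` f b.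
Proof.
case: fhom => _ _ fS; rewrite -!fsup2 fS; congr fsup.
by rewrite image_setU !image_set1.
Qed.

Lemma frame_hom0 : f \bot = \bot.
Proof.
case: fhom => _ _ fS; have -> : (\bot : L) = fsup set0.
  by apply/esym/fsup_eq => // b _; apply: le0x.
rewrite fS image_set0; apply: fsup_eq => // b _; exact: le0x.
Qed.

Lemma frame_hom_rather_below (a b : L) :
  rather_below a b -> rather_below (f a) (f b).
Proof.
case: (fhom) => fT fI fS ab; apply/eqP; rewrite -le1x -fT -ab frame_homU.
rewrite leU2 // fS; apply: fsup_least => _ [x ax <-].
by apply: fsup_ub; rewrite /= -fI ax frame_hom0.
Qed.

Lemma frame_hom_completely_below (a b : L) :
  completely_below a b -> completely_below (f a) (f b).
Proof.
move=> [s [<- <- sP]]; exists (f \o s); split=> // p q p0 pq q1 /=.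
exact/frame_hom_rather_below/sP.
Qed.

Lemma Theta_congruence : congruence (Theta f).
Proof.
case: fhom => fT fI fS; rewrite /Theta; split=> //=.
- by move=> a b c -> ->.
- by move=> a a' b b' aa bb; rewrite !fI aa bb.
move=> S SR; rewrite !fS !image_comp; congr fsup.
by apply/seteqP; split=> _ [xy Sxy <-]; exists xy => //=; rewrite SR.
Qed.

(** Below [a], the homomorphism [f] already sees everything. *)
Lemma Phi_sub_Theta (a : L) : f a = \top -> Phi a `<=` Theta f.
Proof.
case: fhom => fT fI fS aT [x y]; rewrite /Phi /Theta /= => xy.
by rewrite -[f x]meet1x -[f y]meet1x -aT -!fI xy.
Qed.

(** The right adjoint of [f], by [le_comorphism]. *)
Definition comorphism (b : M) : L := fsup [set x | f x <= b].

Lemma le_comorphism (b : M) (x : L) : (x <= comorphism b) = (f x <= b).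
Proof.
case: (fhom) => _ _ fS; apply/idP/idP => [xb|]; last exact: fsup_ub.
apply: le_trans (frame_hom_le fhom xb) _.
by rewrite fS; apply: fsup_least => _ [z zb <-].
Qed.

End FrameHom.

Section FrameSurjection.
Variables (d d' : Order.disp_t) (L : crFrameType d) (M : frameType d').
Variables (q : L -> M) (qhom : frame_hom q) (qsurj : forall y, exists x, q x = y).

Lemma frame_surj_completely_regular (b : M) :
  fsup [set c : M | completely_below c b] = b.
Proof.
apply: fsup_eq => [c /= /completely_below_le//|c h].
case: (qsurj b) h => x <- h.
case: (qhom) => _ _ qS; rewrite -(completely_regular x) qS.
apply: fsup_least => _ [y /= yx <-]; apply: h.
exact: frame_hom_completely_below.
Qed.

Lemma comorphismK (b : M) : q (comorphism q b) = b.
Proof.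
apply/eqP; rewrite eq_le -(le_comorphism qhom) lexx /=.
have [x <-] := qsurj b; apply: (frame_hom_le qhom).
by rewrite (le_comorphism qhom).
Qed.

Lemma comorphism_maxel (b : M) : maxels M b -> maxels L (comorphism q b).
Proof.
case: (qhom) => qT qI _ bmax; have [bT _] := bmax; apply: prime_maxel.
  by rewrite -le1x (le_comorphism qhom) qT le1x.
by move=> x y; rewrite !(le_comorphism qhom) qI; apply: maxel_prime.
Qed.

Lemma pointless_quotient : (forall a, maxels L a -> q a = \top) -> pointless M.
Proof.
move=> qmax; apply/seteqP; split=> // b bmax; have [/eqP bT _] := bmax.
by apply: bT; rewrite -(comorphismK b) (qmax _ (comorphism_maxel bmax)).
Qed.

End FrameSurjection.

(** Surjectivity of [q] makes the induced map a frame homomorphism: subsets and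
    elements of [M] lift to [L], where the identities are those of [f]. *)
Lemma hom_factor (d d1 d2 : Order.disp_t) (L : frameType d) (M : frameType d1)
    (N : frameType d2) (q : L -> M) (f : L -> N) :
  frame_hom q -> (forall y, exists x, q x = y) -> frame_hom f ->
  Theta q `<=` Theta f -> exists2 g : M -> N, frame_hom g & forall x, g (q x) = f x.
Proof.
move=> [qT qI qS] /choice[s sK] [fT fI fS] qf.
have gq x : f (s (q x)) = f x by apply: (qf (_, _)); rewrite /Theta /= sK.
exists (f \o s) => //; split=> /= [|a b|A].
- by rewrite -qT gq.
- by rewrite -[a in LHS]sK -[b in LHS]sK -qI gq fI.
have -> : A = q @` (s @` A).
  rewrite image_comp; apply/seteqP; split=> [y Ay|_ [y Ay <-]] /=.
    by exists y => //=; rewrite sK.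
  by rewrite sK.
rewrite -qS gq fS; congr fsup; rewrite !image_comp.
by apply/seteqP; split=> _ [y Ay <-]; exists y => //=; rewrite gq.
Qed.

(** * The quotient of a frame by a congruence *)

Section Saturation.
Variables (d : Order.disp_t) (L : frameType d) (R : set (L * L)).
Hypothesis cR : congruence R.
Implicit Types (x y : L) (A : set L).

Lemma congruenceU x x' y y' : R (x, x') -> R (y, y') -> R (x `|` y, x' `|` y').
Proof.
case: cR => _ _ _ _ RS xx yy.
have : [set (x, x'); (y, y')] `<=` R by move=> _ [->|->].
by move=> /RS; rewrite !image_setU !image_set1 !fsup2.
Qed.

(** Congruence classes are closed under joins, so this is the largest element
    of the class of [x]. *)
Definition saturate x := fsup [set y | R (x, y)].

Lemma le_saturate x : x <= saturate x.
Proof. by case: cR => Rr _ _ _ _; apply: fsup_ub; apply: Rr. Qed.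

Lemma saturate_rel x : R (x, saturate x).
Proof.
case: cR => Rr _ _ _ RS.
have /RS : [set xy | xy.1 = x /\ R xy] `<=` R by move=> xy [].
congr (R (_, _)).
  apply: fsup_eq => [_ [[y z] [/= -> _ <-]]//|b h].
  by apply: h; exists (x, x) => //; split=> //; apply: Rr.
congr fsup; apply/seteqP; split=> [_ [[y z] /= [-> yz] <-]//|y xy].
by exists (x, y).
Qed.

Lemma saturate_eqP x y : saturate x = saturate y <-> R (x, y).
Proof.
case: cR => _ Rs Rt _ _; split=> [xy|xy].
  by apply: Rt (saturate_rel x) _; rewrite xy; apply/Rs/saturate_rel.
rewrite /saturate; congr fsup; apply/seteqP; split=> z /=; apply: Rt => //.
exact: Rs.
Qed.

Lemma saturate_id x : saturate (saturate x) = saturate x.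
Proof. by case: cR => _ Rs _ _ _; apply/saturate_eqP/Rs/saturate_rel. Qed.

Lemma saturate_mono x y : x <= y -> saturate x <= saturate y.
Proof.
case: (cR) => Rr _ _ _ _ xy; apply: fsup_least => z xz.
have := congruenceU xz (Rr y); move/join_idPr: (xy) => -> yzy.
by apply: le_trans (leUl z y) _; apply: fsup_ub.
Qed.

Lemma saturateI x y : saturate (x `&` y) = saturate x `&` saturate y.
Proof.
case: (cR) => _ _ _ RI _; apply/eqP; rewrite eq_le lexI.
rewrite !saturate_mono ?leIl ?leIr //=.
have /saturate_eqP-> := RI _ _ _ _ (saturate_rel x) (saturate_rel y).
exact: le_saturate.
Qed.

Lemma saturate_le x y : saturate y = y -> (saturate x <= y) = (x <= y).
Proof.
move=> yE; apply/idP/idP; first exact/le_trans/le_saturate.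
by move/saturate_mono; rewrite yE.
Qed.

End Saturation.

(** The quotient is carried by the saturated elements.  The proof of
    [congruence R] is an index of the type, so that the frame structure can be
    inferred from it. *)
Definition quot (d : Order.disp_t) (L : frameType d) (R : set (L * L))
  & congruence R := {x : L | saturate R x == x}.

Section Quotient.
Variables (d : Order.disp_t) (L : frameType d) (R : set (L * L)).
Variable cR : congruence R.

HB.instance Definition _ := SubChoice.on (quot cR).
HB.instance Definition _ := [SubChoice_isSubPOrder of quot cR by <: with d].

Implicit Types (x y z : quot cR) (A : set (quot cR)).

Lemma saturate_val x : saturate R (val x) = val x.
Proof. exact/eqP/(valP x). Qed.

Definition quot_map (a : L) : quot cR :=
  exist _ (saturate R a) (introT eqP (saturate_id cR a)).

Lemma quot_mapK x : quot_map (val x) = x.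
Proof. by apply: val_inj => /=; rewrite saturate_val. Qed.

Lemma quot_leE x y : (x <= y) = (val x <= val y).
Proof. by []. Qed.

Lemma quot_map_le (a : L) x : (quot_map a <= x) = (a <= val x).
Proof. by rewrite quot_leE (saturate_le cR) ?saturate_val. Qed.

Lemma quot_meetP x y z :
  (x <= quot_map (val y `&` val z)) = (x <= y) && (x <= z).
Proof. by rewrite !quot_leE /= (saturateI cR) !saturate_val lexI. Qed.

Lemma quot_joinP x y z :
  (quot_map (val x `|` val y) <= z) = (x <= z) && (y <= z).
Proof. by rewrite quot_map_le leUx. Qed.

HB.instance Definition _ := @Order.POrder_MeetJoin_isLattice.Build d (quot cR)
  (fun x y => quot_map (val x `&` val y)) (fun x y => quot_map (val x `|` val y))
  quot_meetP quot_joinP.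

Lemma quot_le0x x : quot_map \bot <= x.
Proof. by rewrite quot_map_le le0x. Qed.

Lemma quot_lex1 x : x <= quot_map \top.
Proof. by rewrite quot_leE; apply: le_trans (lex1 _) (le_saturate cR _). Qed.

HB.instance Definition _ := @Order.hasBottom.Build d (quot cR) _ quot_le0x.
HB.instance Definition _ := @Order.hasTop.Build d (quot cR) _ quot_lex1.

Definition quot_fsup A : quot cR := quot_map (fsup (val @` A)).

Lemma quot_fsup_le A x : quot_fsup A <= x <-> forall y, A y -> y <= x.
Proof.
rewrite quot_map_le; split=> [h y Ay|h].
  by apply: le_trans h; apply: fsup_ub; exists y.
by apply: fsup_least => _ [y Ay <-]; apply: h.
Qed.

Lemma quot_fsup_supremum A : supremums A (quot_fsup A).
Proof. by split=> [|x Ax]; [apply/quot_fsup_le|apply/quot_fsup_le]. Qed.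

Lemma quot_mapI (a b : L) : quot_map (a `&` b) = quot_map a `&` quot_map b.
Proof. by apply: val_inj; rewrite /= !(saturateI cR) !(saturate_id cR). Qed.

Lemma quot_map_fsup (S : set L) : quot_map (fsup S) = quot_fsup (quot_map @` S).
Proof.
apply/eqP; rewrite eq_le; apply/andP; split.
  rewrite quot_map_le; apply: fsup_least => a Sa; rewrite -quot_map_le.
  by move: (lexx (quot_fsup (quot_map @` S))) => /quot_fsup_le; apply; exists a.
apply/quot_fsup_le => _ [a Sa <-]; rewrite quot_map_le.
exact: le_trans (fsup_ub Sa) (le_saturate cR _).
Qed.

Lemma quot_meet_fsupr x A :
  x `&` quot_fsup A = quot_fsup [set x `&` y | y in A].
Proof.
rewrite -[x in LHS]quot_mapK -quot_mapI meet_fsupr quot_map_fsup !image_comp.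
congr quot_fsup; apply/seteqP; split=> _ [y Ay <-]; exists y => //=;
  by rewrite quot_mapI !quot_mapK.
Qed.

HB.instance Definition _ := @TBLattice_isFrame.Build d (quot cR)
  quot_fsup quot_fsup_supremum quot_meet_fsupr.

Lemma quot_map_frame_hom : frame_hom quot_map.
Proof. by split; [|exact: quot_mapI|exact: quot_map_fsup]. Qed.

Lemma quot_map_surj x : exists a, quot_map a = x.
Proof. by exists (val x); apply: quot_mapK. Qed.

Lemma Theta_quot_map : Theta quot_map = R.
Proof.
apply/seteqP; split=> [[a b] /= ab|[a b] /(saturate_eqP cR) ab].
  exact/(saturate_eqP cR)/(congr1 val ab).
exact: val_inj.
Qed.

End Quotient.

HB.instance Definition _ (d : Order.disp_t) (L : crFrameType d)
    (R : set (L * L)) (cR : congruence R) :=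
  @Frame_isCompletelyRegular.Build d (quot cR)
    (frame_surj_completely_regular (quot_map_frame_hom cR) (@quot_map_surj _ _ _ cR)).

(** * Skinny homomorphisms to pointless frames *)

Lemma skinny_to_pointless (d d' : Order.disp_t) (L : frameType d)
    (M : crFrameType d') (f : L -> M) :
  pointless M -> is_skinny f <-> forall a, maxels L a -> f a = \top.
Proof.
move=> pM; split=> [skf a /skf/pi_map_topP/(_ (f a)) faT|fmax a /fmax->].
  apply: faT => // -[c /maxels_himp].
  by rewrite pM.
by apply/pi_map_topP => b _; rewrite le1x => /eqP.
Qed.

(** Every frame homomorphism between pointless frames is skinny, because its
    domain has no maximal elements. *)
Lemma pointless_skinny (d d' : Order.disp_t) (L : frameType d)
    (M : frameType d') (f : L -> M) : pointless L -> is_skinny f.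
Proof. by move=> pL a; rewrite pL. Qed.

Definition max_cong (d : Order.disp_t) (L : frameType d) : set (L * L) :=
  cong_join [set Phi a | a in maxels L].

Lemma max_cong_congruence (d : Order.disp_t) (L : frameType d) :
  congruence (@max_cong d L).
Proof. by case: (cong_join_lub [set Phi a | a in maxels L]). Qed.

(** The half of the universal property that existence of factorizations needs:
    every competing homomorphism identifies at least what [max_cong L] does. *)
Lemma max_cong_sub_Theta (d d' : Order.disp_t) (L : frameType d)
    (M : crFrameType d') (f : L -> M) :
  pointless M -> frame_hom f -> is_skinny f -> @max_cong d L `<=` Theta f.
Proof.
move=> pM fhom /(skinny_to_pointless _ pM) fmax.
case: (cong_join_lub [set Phi a | a in maxels L]) => _ _; apply.
  exact: Theta_congruence.
by move=> _ [a amax <-]; apply: Phi_sub_Theta; rewrite ?fmax.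
Qed.

(** Over a pointless codomain the side condition [e a = \top] in the class E is
    automatic, which makes the required kernel depend on [L] alone. *)
Lemma class_E_pointless (d d' : Order.disp_t) (L : crFrameType d)
    (M : crFrameType d') (e : skinny_hom L M) :
  pointless M ->
  class_E e <-> (forall y, exists x, e x = y) /\ Theta e = @max_cong d L.
Proof.
move=> pM; rewrite /class_E /max_cong.
have -> // : [set a | maxels L a /\ e a = \top] = maxels L.
apply/seteqP; split=> [a []//|a amax]; split=> //.
exact: ((skinny_to_pointless e pM).1 (skinny_is_skinny e)).
Qed.

Section Reflection.
Variables (d : Order.disp_t) (L : crFrameType d).

Definition pl_quot : crFrameType d := quot (@max_cong_congruence d L).

Definition pl_map : L -> pl_quot := quot_map (@max_cong_congruence d L).

Lemma pl_map_maxel (a : L) : maxels L a -> pl_map a = \top.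
Proof.
move=> amax.
(* The top of the quotient is by definition the class of the top. *)
suff : Theta pl_map (a, \top) by [].
rewrite Theta_quot_map => S _; apply; first by exists a.
by rewrite /Phi /= meetxx meetx1.
Qed.

Lemma pl_quot_pointless : pointless pl_quot.
Proof.
apply: (@pointless_quotient _ _ _ _ pl_map) pl_map_maxel.
  exact: quot_map_frame_hom.
exact: quot_map_surj.
Qed.

Definition pl_arrow : skinny_hom L pl_quot :=
  SkinnyHom (quot_map_frame_hom _)
    ((skinny_to_pointless pl_map pl_quot_pointless).2 pl_map_maxel).

Lemma pl_arrow_surj y : exists x, pl_arrow x = y.
Proof. exact: quot_map_surj. Qed.

Lemma Theta_pl_arrow : Theta pl_arrow = @max_cong d L.
Proof. exact: Theta_quot_map. Qed.

Lemma pl_arrow_reflector :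
  @reflector_arrow (Fs d) (@plFs d) L pl_quot pl_arrow.
Proof.
split=> [|Z pZ f]; first exact: pl_quot_pointless.
have sub : Theta pl_arrow `<=` Theta f.
  rewrite Theta_pl_arrow.
  exact: max_cong_sub_Theta pZ (skinny_frame_hom f) (skinny_is_skinny f).
have [g ghom gE] := hom_factor (skinny_frame_hom pl_arrow) pl_arrow_surj
  (skinny_frame_hom f) sub.
exists (SkinnyHom ghom (pointless_skinny g pl_quot_pointless)).
split=> [|h hE]; first exact: skinny_hom_eq.
apply: skinny_hom_eq => y; have [x <-] := pl_arrow_surj y.
by rewrite /= gE -hE.
Qed.

End Reflection.

(** * The reflection theorem *)

(** Compare [r] with [pl_arrow] by maps [g] and [h] given by the two universal
    properties.  That each factors through the other gives equality of kernels;
    uniqueness for [r] gives [h \o g = id], so [r] inherits surjectivity. *)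
Lemma reflector_arrow_class_E (d : Order.disp_t) (L M : crFrameType d)
    (r : skinny_hom L M) :
  @reflector_arrow (Fs d) (@plFs d) L M r -> class_E r.
Proof.
move=> [pM rU]; apply/(class_E_pointless _ pM).
have [_ qU] := pl_arrow_reflector L.
have [g [gr _]] := rU _ (@pl_quot_pointless d L) (pl_arrow L).
have [h [hq _]] := qU _ pM r.
have grE x : g (r x) = pl_arrow L x by rewrite -gr.
have hqE x : h (pl_arrow L x) = r x by rewrite -hq.
have hg y : h (g y) = y.
  have [k [_ kU]] := rU _ pM r.
  have kid : k = skinny_id M by apply: kU; apply: skinny_hom_eq.
  have khg : k = skinny_comp h g.
    by apply: kU; apply: skinny_hom_eq => x /=; rewrite grE hqE.
  by rewrite -[h (g y)]/(skinny_comp h g y) -khg kid.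
split=> [y|].
  by have [x gx] := pl_arrow_surj (g y); exists x; rewrite -hqE gx hg.
have qr x y : pl_arrow L x = pl_arrow L y <-> r x = r y.
  by split=> xy; [rewrite -!hqE xy|rewrite -!grE xy].
rewrite -Theta_pl_arrow; apply/seteqP.
by split=> -[x y]; [apply: (qr x y).2|apply: (qr x y).1].
Qed.

Theorem theorem4p3p3 (d : Order.disp_t) : reflective_within (@plFs d) (@Fs_E d).
Proof.
split=> [L|L M r]; last exact: reflector_arrow_class_E.
by exists (pl_quot L), (pl_arrow L); apply: pl_arrow_reflector.
Qed.
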